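(* Let $\mu\in Cra$ be a measure on $\mathbb{R}$, let $\{p_n\}_{n\ge 0}$ be the sequence of polynomials orthogonal with respect to $\mu$, and let $\hat p_n=\int_{\operatorname{supp}\mu}p_n(x)^2\,d\mu(x)>0$. Let $\{c_n\}_{n\ge 0}$ be a sequence of real numbers with $\sum_{n\ge 0}c_n^2\hat p_n<\infty$, and let $f$ denote the mean-square sum (the limit in $L_2(\mu)$) of the orthogonal series $\sum_{n\ge 0}c_np_n(x)$. Let $\mathcal{M}$ be a closed subset of $\operatorname{supp}(\mu)$. Then the following two conditions are equivalent: a) $f(x)\ge 0$ $\mu$-a.s. on $\mathcal{M}$; b) there exists $\nu\in AC2^{+}(\mu)$ with $\operatorname{supp}(\nu)=\mathcal{M}$ such that $f(x)=\frac{d\nu}{d\mu}(x)$. If one of the conditions a) and b) is satisfied, then the coefficients $c_n$ are given by $$c_n=\frac{1}{\hat p_n}\int_{\mathcal{M}}p_n(x)\,d\nu(x),\qquad n\ge 0 .$$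
   Context: All (signed) measures are $\sigma$-finite; ''measure'' without the adjective ''signed'' means a nonnegative measure. For a signed measure $\chi$ with Hahn–Jordan decomposition $\chi=\chi^+-\chi^-$ write $|\chi|=\chi^++\chi^-$. $Cra$ is the set of all signed measures $\chi$ on $\mathbb{R}$ for which there exists $\delta>0$ with $\int\exp(\delta|x|)\,d|\chi|(x)<\infty$. $L_2(\mu)$ is the set of real functions on $\operatorname{supp}(\mu)$ that are square-integrable with respect to $|\mu|$. For a measure $\mu$, $AC2(\mu)=\{f\,d\mu: f\in L_2(\mu)\}$, i.e. the signed measures absolutely continuous with respect to $\mu$ with Radon–Nikodym derivative in $L_2(\mu)$; $AC2^{+}(\mu)$ is the subset of those elements of $AC2(\mu)$ that are (nonnegative) measures. The orthogonal polynomials $\{p_n\}_{n\ge0}$ satisfy $\deg p_n=n$ and $\int_{\operatorname{supp}\mu}p_np_m\,d\mu=\hat p_n\delta_{mn}$ with $\hat p_n>0$.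
   Formalization: Condition a) is strengthened: besides f ≥ 0 μ-a.s. on M, it also requires M to be the support of the signed measure f dμ. Without this a) does not imply b), e.g. μ uniform on [-1,1], f = 1, M = {0}. *)

(* Defs.v *)
(* MathComp / MathComp-Analysis *)
From HB Require Import structures.
From mathcomp Require Import all_boot all_order all_algebra.
From mathcomp Require Import all_classical all_reals all_analysis.

Set Implicit Arguments.
Unset Strict Implicit.
Unset Printing Implicit Defensive.

Import Order.TTheory GRing.Theory Num.Theory.
Import numFieldNormedType.Exports.

Local Open Scope classical_set_scope.
Local Open Scope ring_scope.

(* Topological support.  For a signed measure, apply it to the total
   variation. *)
Definition supp (R : realType) (m : set R -> \bar R) : set R :=
  [set x | forall U : set R, open U -> U x -> (0 < m U)%E].

(* Membership in Cra of a nonnegative measure, for which |mu| = mu. *)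
Definition Cra (R : realType)
    (mu : {sigma_finite_measure set (measurableTypeR R) -> \bar R}) : Prop :=
  exists2 delta : R, 0 < delta &
    (\int[mu]_x (expR (delta * `|x|))%:E < +oo)%E.

(* A function on supp mu is represented by a function on R whose values
   outside supp mu are never used. *)
Definition L2 (R : realType)
    (mu : {sigma_finite_measure set (measurableTypeR R) -> \bar R})
    (g : measurableTypeR R -> R) : Prop :=
  measurable_fun (supp mu) g /\
  (\int[mu]_(x in supp mu) (g x ^+ 2)%:E < +oo)%E.

(* The set function g dmu, for g defined on supp mu. *)
Definition density (R : realType)
    (mu : {sigma_finite_measure set (measurableTypeR R) -> \bar R})
    (g : measurableTypeR R -> R) (A : set R) : \bar R :=
  (\int[mu]_(x in A `&` supp mu) (g x)%:E)%E.

(* A charge is finite; this loses nothing when mu is in Cra, since mu is then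
   finite and L2 functions are integrable. *)
Definition AC2 (R : realType)
    (mu : {sigma_finite_measure set (measurableTypeR R) -> \bar R})
    (chi : {charge set (measurableTypeR R) -> \bar R}) : Prop :=
  exists2 g : measurableTypeR R -> R, L2 mu g &
    forall A : set (measurableTypeR R), measurable A -> chi A = density mu g A.

Definition AC2plus (R : realType)
    (mu : {sigma_finite_measure set (measurableTypeR R) -> \bar R})
    (nu : {finite_measure set (measurableTypeR R) -> \bar R}) : Prop :=
  AC2 mu (charge_of_finite_measure nu).

Definition phat (R : realType)
    (mu : {sigma_finite_measure set (measurableTypeR R) -> \bar R})
    (p : nat -> {poly R}) (n : nat) : R :=
  \int[mu]_(x in supp mu) ((p n).[x] ^+ 2).

Definition orthogonal_polys (R : realType)
    (mu : {sigma_finite_measure set (measurableTypeR R) -> \bar R})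
    (p : nat -> {poly R}) : Prop :=
  [/\ forall n, size (p n) = n.+1,
      forall n m, \int[mu]_(x in supp mu) ((p n).[x] * (p m).[x]) =
                  phat mu p n * (n == m)%:R
    & forall n, 0 < phat mu p n].

Definition mean_square_sum (R : realType)
    (mu : {sigma_finite_measure set (measurableTypeR R) -> \bar R})
    (p : nat -> {poly R}) (c : nat -> R) (f : measurableTypeR R -> R) : Prop :=
  L2 mu f /\
  (fun n : nat => \int[mu]_(x in supp mu)
     ((f x - \sum_(k < n) c k * (p k).[x]) ^+ 2)%:E)%E @ \oo --> 0%E.

Definition nonneg_on (R : realType)
    (mu : {sigma_finite_measure set (measurableTypeR R) -> \bar R})
    (M : set R) (f : measurableTypeR R -> R) : Prop :=
  {ae mu, forall x, M x -> 0 <= f x}.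

(* M is the support of the signed measure f dmu, whose total variation is
   |f| dmu.  Without this link between f and M, nonnegativity on M does not
   give a nu with dnu/dmu = f and supp nu = M: take mu uniform on [-1, 1],
   f(x) = x and M = [0, 1], or f = 1 and M = {0}. *)
Definition supported_on (R : realType)
    (mu : {sigma_finite_measure set (measurableTypeR R) -> \bar R})
    (M : set R) (f : measurableTypeR R -> R) : Prop :=
  supp (density mu (fun x => `|f x|)) = M.

Definition is_density_of (R : realType)
    (mu : {sigma_finite_measure set (measurableTypeR R) -> \bar R})
    (M : set R) (f : measurableTypeR R -> R)
    (nu : {finite_measure set (measurableTypeR R) -> \bar R}) : Prop :=
  [/\ AC2plus mu nu,
      supp nu = M
    & {ae mu, forall x, supp mu x ->
         (f x)%:E = Radon_Nikodym (charge_of_finite_measure nu) mu x}].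

(* Main.v *)
(* A measure on R gives no mass to the complement of its support, by second
   countability.  If f >= 0 on M and M is the support of |f| dmu, then f = 0
   mu-a.e. outside M, so f = |f| mu-a.e. and nu = |f| dmu is the required
   measure; conversely Radon-Nikodym derivatives of measures are a.e.
   nonnegative, which gives |f| dmu = nu.  The exponential moment makes every
   polynomial square-integrable, so c_n phat_n is the limit of the integrals of
   p_n against the partial sums, that is, the integral of p_n f dmu = p_n dnu,
   and nu lives on M. *)
Require Import Defs.
From HB Require Import structures.
From mathcomp Require Import all_boot all_order all_algebra.
From mathcomp Require Import measurable_realfun.
From mathcomp Require Import all_classical all_reals all_analysis.
From mathcomp Require Import ring lra.
Import Order.TTheory GRing.Theory Num.Theory.
Import numFieldNormedType.Exports.
Local Open Scope classical_set_scope.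
Local Open Scope ring_scope.

Set Implicit Arguments.
Unset Strict Implicit.
Unset Printing Implicit Defensive.

(** * The support of a measure on the line *)

Section support.
Context {R : realType} (m : {measure set (measurableTypeR R) -> \bar R}).

Lemma closed_supp : closed (supp m).
Proof.
rewrite -openC openE => x /existsNP[U /not_implyP[oU /not_implyP[Ux U0]]].
rewrite /interior nbhsE; exists U; first by split.
by move=> y Uy /(_ U oU Uy).
Qed.

Lemma measurable_supp : measurable (supp m : set (measurableTypeR R)).
Proof. by apply: closed_measurable; exact: closed_supp. Qed.

(** A point off the support has an open neighbourhood of measure zero, hence lies in a null interval
    with rational endpoints; there are countably many of these. *)
Lemma measure_setC_supp : m (~` supp m) = 0%E.
Proof.
suff : m.-negligible (~` supp m).
  by apply: measure_negligible; exact: measurableC measurable_supp.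
pose J (q : rat * rat) : set R := `]ratr q.1, ratr q.2[%classic.
(* [F] enumerates the null rational intervals: a code that decodes to no pair, or to an interval of
   nonzero mass, yields [set0], so every [F k] is negligible. *)
pose F k := if unpickle k is Some q then if m (J q) == 0%E then J q else set0
            else set0.
apply: (@negligibleS _ _ _ m (\bigcup_k F k)); last first.
  apply: negligible_bigcup => k; rewrite /F.
  case: unpickle => [q|]; last exact: negligible_set0.
  case: eqP => [Jq0|_]; last exact: negligible_set0.
  by apply/negligibleP => //; exact: measurable_itv.
move=> x /existsNP[U /not_implyP[oU /not_implyP[Ux U0]]].
have : nbhs x U by rewrite nbhsE /=; exists U.
rewrite -nbhs_ballE => -[_/posnumP[r] xrU].
have /rat_in_itvoo[a] : x - r%:num < x by rewrite ltrBlDr ltrDl.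
have /rat_in_itvoo[b] : x < x + r%:num by rewrite ltrDl.
rewrite !in_itv/= => /andP[xb bxr] /andP[xra ax].
exists (pickle (a, b)); first by [].
rewrite /F pickleK.
have -> : m (J (a, b)) = 0%E.
  apply/eqP; rewrite -measure_le0.
  have mU0 : (m U <= 0)%E by rewrite leNgt; exact/negP.
  apply: le_trans mU0; apply: le_measure; rewrite ?inE.
  - exact: measurable_itv.
  - exact: open_measurable.
  - move=> y; rewrite /J/= in_itv/= => /andP[ay yb]; apply: xrU.
    by rewrite /ball/= ltr_distlC; apply/andP; split; lra.
by rewrite eqxx /J/= in_itv/= ax xb.
Qed.

End support.

(** * Exponential moments and integrability of polynomials *)

(** With [b = a / (k + 1)], raise [b * x <= 1 + b * x <= expR (b * x)] to the power [k] and use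
    [k * b <= a]. Dividing by [k + 1] rather than [k] covers [k = 0]. *)
Lemma exprn_le_expR {R : realType} (a x : R) (k : nat) : 0 < a -> 0 <= x ->
  x ^+ k <= (a / k.+1%:R) ^- k * expR (a * x).
Proof.
move=> a0 x0; set b := a / k.+1%:R.
have b0 : 0 < b by rewrite divr_gt0.
have bx0 : 0 <= b * x by rewrite mulr_ge0 // ltW.
rewrite [leRHS]mulrC ler_pdivlMr ?exprn_gt0// -exprMn (mulrC x).
apply: (@le_trans _ _ (expR (b * x) ^+ k)).
  apply: lerXn2r; rewrite ?nnegrE ?expR_ge0//.
  by apply: le_trans (expR_ge1Dx _); rewrite lerDr.
rewrite -expRM_natr ler_expR /b [leLHS](_ : _ = a * x * (k%:R / k.+1%:R)).
  by rewrite ler_piMr ?mulr_ge0 ?(ltW a0)// ler_pdivrMr ?mul1r ?ler_nat.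
by ring.
Qed.

Section exponential_moment.
Context {R : realType}
  (mu : {sigma_finite_measure set (measurableTypeR R) -> \bar R}).
Hypothesis mu_Cra : Cra mu.

Let measurable_expR_norm (a : R) :
  measurable_fun [set: measurableTypeR R] (fun x => expR (a * `|x|)).
Proof.
apply: (@measurableT_comp _ _ _ _ _ _ (@expR R)) => //.
by apply: measurable_funM => //; exact: normr_measurable.
Qed.

Lemma Cra_integrable_exp : exists2 a : R, 0 < a &
  mu.-integrable setT (fun x => (expR (a * `|x|))%:E).
Proof.
have [a a0 oo] := mu_Cra; exists a => //; apply/integrableP; split.
  exact/measurable_EFinP.
by under eq_integral => x _ do rewrite gee0_abs ?lee_fin ?expR_ge0//.
Qed.

Lemma Cra_integrable_Xn (k : nat) :
  mu.-integrable setT (fun x : measurableTypeR R => (x ^+ k)%:E).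
Proof.
have [a a0 ia] := Cra_integrable_exp.
apply: (@le_integrable _ _ _ mu setT measurableT _
  (fun x => (((a / k.+1%:R) ^- k)%:E * (expR (a * `|x|))%:E)%E)).
- apply/measurable_EFinP; exact: (exprn_measurable k).
- move=> x _; rewrite -EFinM !abse_EFin lee_fin normrX.
  rewrite (le_trans _ (ler_norm _))// exprn_le_expR//.
- exact: integrableZl.
Qed.

Lemma Cra_integrable_horner (q : {poly R}) :
  mu.-integrable setT (fun x : measurableTypeR R => q.[x]%:E).
Proof.
apply: (@eq_integrable _ _ _ mu setT measurableT (fun x : measurableTypeR R =>
    \sum_(i < size q) ((q`_i)%:E * (x ^+ i)%:E)%E)).
  move=> x _; rewrite horner_coef -sumEFin; apply: eq_bigr => i _.
  by rewrite EFinM.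
apply: integrable_sum => // i _.
exact: integrableZl (Cra_integrable_Xn i).
Qed.

End exponential_moment.

(** Keeps the product inside the real numbers, the form in which the side conditions of the
    real-valued integral arise. *)
Lemma integrableZl_EFin d (T : measurableType d) (R : realType)
    (mu : {measure set T -> \bar R}) (D : set T) (k : R) (f : T -> R) :
  measurable D -> mu.-integrable D (EFin \o f) ->
  mu.-integrable D (EFin \o (fun x => k * f x)).
Proof.
by move=> mD /(integrableZl mD k); exact: eq_integrable.
Qed.

(** * Square-integrable functions on the support *)

Section L2.
Context {R : realType}
  (mu : {sigma_finite_measure set (measurableTypeR R) -> \bar R}).
Implicit Types g h : measurableTypeR R -> R.

Let mS : measurable (supp mu : set (measurableTypeR R)) := measurable_supp mu.

Lemma L2_integrable_sqr g : L2 mu g ->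
  mu.-integrable (supp mu) (fun x => (g x ^+ 2)%:E).
Proof.
move=> [mg goo]; apply/integrableP; split.
  by apply/measurable_EFinP; exact: measurable_funX.
by under eq_integral => x _ do rewrite gee0_abs ?lee_fin ?sqr_ge0//.
Qed.

(** Domination: [|g h| <= g^2 + h^2]. *)
Lemma L2_integrableM g h : L2 mu g -> L2 mu h ->
  mu.-integrable (supp mu) (fun x => (g x * h x)%:E).
Proof.
move=> Lg Lh.
apply: (@le_integrable _ _ _ mu _ mS _
    (fun x => ((g x ^+ 2)%:E + (h x ^+ 2)%:E)%E)).
- by apply/measurable_EFinP/measurable_funM; [case: Lg|case: Lh].
- move=> x _; rewrite -EFinD !abse_EFin lee_fin normrM.
  rewrite -[g x ^+ 2]real_normK ?num_real// -[h x ^+ 2]real_normK ?num_real//.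
  rewrite (le_trans _ (ler_norm _))//.
  move: `|g x| `|h x| (normr_ge0 (g x)) (normr_ge0 (h x)) => a b a0 b0.
  nra.
- by apply: integrableD => //; exact: L2_integrable_sqr.
Qed.

Lemma L2B g h : L2 mu g -> L2 mu h -> L2 mu (fun x => g x - h x).
Proof.
move=> Lg Lh; have [[mg _] [mh _]] := (Lg, Lh).
split; first exact: measurable_funB.
suff : mu.-integrable (supp mu) (fun x => ((g x - h x) ^+ 2)%:E).
  exact: integrable_lty.
apply: (@eq_integrable _ _ _ mu _ mS
    (fun x => ((g x ^+ 2)%:E + (h x ^+ 2)%:E - 2%:E * (g x * h x)%:E)%E)).
  by move=> x _; rewrite -!EFinM -!EFinD; congr EFin; ring.
apply: integrableB => //.
  by apply: integrableD => //; exact: L2_integrable_sqr.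
by apply: integrableZl => //; exact: L2_integrableM.
Qed.

Lemma L2_norm g : L2 mu g -> L2 mu (fun x => `|g x|).
Proof.
move=> [mg goo]; split; first exact: measurableT_comp.
by under eq_integral do rewrite real_normK ?num_real//.
Qed.

Hypothesis mu_Cra : Cra mu.

Lemma L2_horner (q : {poly R}) : L2 mu (horner q).
Proof.
split; first exact: measurable_poly.
apply: integrable_lty => //; apply: (@integrableS _ _ _ _ setT) => //.
under eq_fun do rewrite -horner_exp.
exact: Cra_integrable_horner.
Qed.

(** The constant polynomial 1 is in [L2] thanks to the exponential moment, and a product of two [L2]
    functions is integrable. *)
Lemma L2_integrable g : L2 mu g -> mu.-integrable (supp mu) (EFin \o g).
Proof.
move=> Lg; have := L2_integrableM Lg (L2_horner 1).
by under eq_fun do rewrite hornerC mulr1.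
Qed.

End L2.

(** * Fourier coefficients of the mean-square sum *)

Section coefficients.
Context {R : realType}
  (mu : {sigma_finite_measure set (measurableTypeR R) -> \bar R}).
Variables (p : nat -> {poly R}) (c : nat -> R) (f : measurableTypeR R -> R).
Hypotheses (mu_Cra : Cra mu) (p_orth : orthogonal_polys mu p).

Let mS : measurable (supp mu : set (measurableTypeR R)) := measurable_supp mu.

Let s N : {poly R} := \sum_(k < N) c k *: p k.

(** Linearity, by induction on [N], reduces this to the orthogonality relations, which leave only
    the term [k = n]. *)
Lemma Rintegral_mul_partial_sum n N : (n < N)%N ->
  \int[mu]_(x in supp mu) ((p n).[x] * (s N).[x]) = c n * phat mu p n.
Proof.
have [_ orth _] := p_orth.
have -> : \int[mu]_(x in supp mu) ((p n).[x] * (s N).[x]) =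
    \sum_(k < N) c k * (phat mu p n * (n == k)%:R).
  rewrite /s; elim: N => [|N IH].
    rewrite !big_ord0; under eq_Rintegral do rewrite horner0 mulr0.
    by rewrite Rintegral_cst// mul0r.
  rewrite !big_ord_recr/= -IH -orth -RintegralZl//; last first.
    by apply: L2_integrableM; exact: L2_horner.
  rewrite -RintegralD//; last 2 first.
  - by apply: L2_integrableM; exact: L2_horner.
  - by apply: integrableZl_EFin => //; apply: L2_integrableM; exact: L2_horner.
  by apply: eq_Rintegral => x _; rewrite hornerD hornerZ; ring.
move=> nN; rewrite (bigD1 (Ordinal nN))//= eqxx mulr1 big1 ?addr0// => k.
by rewrite -val_eqE/= eq_sym => /negbTE ->; rewrite !mulr0.
Qed.

(** For [n < N] the gap [e] between the two sides is the integral of [p n] against the error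
    [f - s N]. A weighted AM-GM bound replaces Cauchy-Schwarz, and a nonzero gap contradicts
    mean-square convergence. *)
Lemma mean_square_sum_coef n : mean_square_sum mu p c f ->
  \int[mu]_(x in supp mu) ((p n).[x] * f x) = c n * phat mu p n.
Proof.
move=> [Lf /fine_cvgP[_ fcvg]]; apply/eqP; rewrite -subr_eq0 -normr_le0.
set e := _ - _; rewrite leNgt; apply/negP => e0.
pose K := phat mu p n.
have K0 : 0 < K by case: p_orth => _ _ /(_ n).
(* Chosen so that [t * (K + 1) = |e|]: once the squared error is below [t^2], the bound [le_e] gives
   [2 |e| < t K + t = |e|]. *)
pose t := `|e| / (K + 1); have t0 : 0 < t by rewrite divr_gt0// addr_gt0.
have Ld N : L2 mu (fun x => f x - (s N).[x]) by apply/L2B/L2_horner.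
have Lpn : L2 mu (horner (p n)) by exact: L2_horner.
have le_e N : (n < N)%N -> 2 * `|e| <=
    t * K + t^-1 * \int[mu]_(x in supp mu) ((f x - (s N).[x]) ^+ 2).
  move=> nN.
  have -> : e = \int[mu]_(x in supp mu) ((p n).[x] * (f x - (s N).[x])).
    rewrite /e -(Rintegral_mul_partial_sum nN) -RintegralB//;
      try exact: L2_integrableM.
      by apply: eq_Rintegral => x _; rewrite mulrBr.
    by apply: L2_integrableM => //; exact: L2_horner.
  have iM := L2_integrableM Lpn (Ld N).
  rewrite /K /phat -!RintegralZl//; try exact: L2_integrable_sqr.
  rewrite -RintegralD//; last 2 first.
  - by apply: integrableZl_EFin => //; exact: L2_integrable_sqr.
  - by apply: integrableZl_EFin => //; exact: L2_integrable_sqr.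
  have iA := integrable_norm iM.
  apply: (@le_trans _ _ (2 * \int[mu]_(x in supp mu)
      `|(p n).[x] * (f x - (s N).[x])|)).
    by rewrite ler_pM2l//; exact: le_normr_Rintegral.
  rewrite -RintegralZl//; apply: le_Rintegral => //.
  - exact: integrableZl_EFin.
  - exact: (integrableD mS (integrableZl_EFin t mS (L2_integrable_sqr Lpn))
      (integrableZl_EFin t^-1 mS (L2_integrable_sqr (Ld N)))).
  - move=> x _; set u := (p n).[x]; set v := f x - _.
    (* AM-GM: [2 |u v| <= t u^2 + v^2 / t] *)
    have := sqr_ge0 (t * `|u| - `|v|); rewrite normrM.
    rewrite -(@real_normK _ u) ?num_real// -(@real_normK _ v) ?num_real//.
    move: `|u| `|v| => a b h.
    rewrite -(ler_pM2l t0) -subr_ge0 (le_trans h)// le_eqVlt; apply/orP; left.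
    by apply/eqP; field; exact: lt0r_neq0.
move/cvgrPdist_lt : fcvg => /(_ _ (exprn_gt0 2 t0)) -[N _ hN].
have := hN (maxn n.+1 N) (leq_maxr _ _).
have /le_e := leq_maxl n.+1 N; set m := maxn _ _ => em.
rewrite sub0r normrN /=.
under eq_integral => x _.
  have -> : \sum_(k < m) c k * (p k).[x] = (s m).[x].
    by rewrite /s horner_sum; apply: eq_bigr => k _; rewrite hornerZ.
  over.
rewrite -/(Rintegral _ _ _) => /(le_lt_trans (ler_norm _)) dm.
have : 2 * `|e| < t * K + t.
  by rewrite (le_lt_trans em)// ltrD2l mulrC ltr_pdivrMr.
rewrite -[X in _ + X]mulr1 -mulrDr /t divfK ?lt0r_neq0 ?addr_gt0//.
by move: e0; lra.
Qed.

End coefficients.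

(** * The finite measure with a given nonnegative integrable density *)

Section integral_measure.
Context d (T : measurableType d) (R : realType)
  (mu : {measure set T -> \bar R}) (h : T -> R).

(** The proofs of nonnegativity and integrability are arguments so that the measure and
    finite-measure instances below can be inferred from the term itself. *)
Definition integral_measure of (forall x, 0 <= h x) &
    mu.-integrable setT (EFin \o h) : set T -> \bar R :=
  fun A => (\int[mu]_(x in A) (h x)%:E)%E.

Hypotheses (h0 : forall x, 0 <= h x) (ih : mu.-integrable setT (EFin \o h)).

Let nu := integral_measure h0 ih.

Let nu_set0 : nu set0 = 0%E. Proof. exact: integral_set0. Qed.

Let nu_ge0 A : (0 <= nu A)%E.
Proof. by apply: integral_ge0 => x _; rewrite lee_fin. Qed.

Let nu_sigma_additive : semi_sigma_additive nu.
Proof.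
apply: semi_sigma_additive_nng_induced; first exact: measurable_int ih.
by move=> x; rewrite lee_fin.
Qed.

HB.instance Definition _ := isMeasure.Build _ _ _ (integral_measure h0 ih)
  nu_set0 nu_ge0 nu_sigma_additive.

Let nu_fin : fin_num_fun nu.
Proof.
by move=> A mA; apply: integrable_fin_num => //; exact: integrableS ih.
Qed.

HB.instance Definition _ := @Measure_isFinite.Build _ _ _
  (integral_measure h0 ih) nu_fin.

End integral_measure.

(** * Radon-Nikodym derivatives of measures *)

(** [Radon_Nikodym] is defined for charges, so its sign is not built in; it agrees almost everywhere
    with [Radon_Nikodym_SigmaFinite.f], which is nonnegative everywhere. *)
Lemma Radon_Nikodym_ge0 d (T : measurableType d) (R : realType)
    (nu : {finite_measure set T -> \bar R})
    (mu : {sigma_finite_measure set T -> \bar R}) : nu `<< mu ->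
  {ae mu, forall x, (0 <= Radon_Nikodym (charge_of_finite_measure nu) mu x)%E}.
Proof.
move=> numu.
have := ae_eq_Radon_Nikodym_SigmaFinite numu measurableT.
apply: filterS => x /(_ I) <-.
exact: Radon_Nikodym_SigmaFinite.f_ge0.
Qed.

Lemma integral_Radon_Nikodym d (T : measurableType d) (R : realType)
    (nu : {finite_measure set T -> \bar R})
    (mu : {sigma_finite_measure set T -> \bar R}) (A : set T) :
  nu `<< mu -> measurable A ->
  (\int[mu]_(x in A) Radon_Nikodym (charge_of_finite_measure nu) mu x)%E = nu A.
Proof.
by move=> numu mA; rewrite -(@Radon_Nikodym_integral _ _ _
  (charge_of_finite_measure nu)).
Qed.

(** * Measures whose density is the mean-square sum *)

Section density.
Context {R : realType}
  (mu : {sigma_finite_measure set (measurableTypeR R) -> \bar R}).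
Implicit Types (g f : measurableTypeR R -> R)
  (nu : {finite_measure set (measurableTypeR R) -> \bar R}).

Let mS : measurable (supp mu : set (measurableTypeR R)) := measurable_supp mu.

Lemma AC2plus_dominates nu : AC2plus mu nu -> nu `<< mu.
Proof.
move=> [g [mg _] nuE]; apply/null_content_dominatesP => A mA muA0.
have mAS : measurable (A `&` supp mu) by exact: measurableI.
rewrite -[nu A]/(charge_of_finite_measure nu A) (nuE A mA).
rewrite /density null_set_integral//.
  by apply/measurable_EFinP; apply: measurable_funS mg.
exact: subset_measure0 muA0.
Qed.

Lemma is_density_of_ge0 M f nu : is_density_of mu M f nu ->
  {ae mu, forall x, supp mu x -> 0 <= f x}.
Proof.
move=> [/AC2plus_dominates numu _]; apply: filterS2 (Radon_Nikodym_ge0 numu).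
by move=> x + h Sx; rewrite -h// lee_fin.
Qed.

(** On [supp mu], almost everywhere, [f] is the derivative of a measure and so equals [|f|]; the
    complement of [supp mu] is null. This identifies the support of [|f| dmu] with that of [nu]. *)
Lemma is_density_of_norm M f nu (A : set (measurableTypeR R)) :
  measurable_fun (supp mu) f -> is_density_of mu M f nu -> measurable A ->
  density mu (fun x => `|f x|) A = nu A.
Proof.
move=> mf fnu mA; have f0 := is_density_of_ge0 fnu.
have [/AC2plus_dominates numu _ fE] := fnu.
have mAS : measurable (A `&` supp mu) by exact: measurableI.
have iRN := @Radon_Nikodym_integrable _ _ _
  (charge_of_finite_measure nu) mu numu.
rewrite -(integral_Radon_Nikodym numu mA).
rewrite [RHS](@negligible_integral _ _ _ mu A (~` supp mu))//; last 3 first.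
- exact: measurableC.
- exact: integrableS iRN.
- exact: measure_setC_supp.
rewrite setDE setCK; apply: ae_eq_integral => //.
- apply/measurable_EFinP; apply: measurableT_comp => //.
  exact: measurable_funS mf.
- by apply: measurable_funTS; exact: measurable_int iRN.
apply: (@filterS2 _ _ (ae_filter_ringOfSetsType mu)) f0 fE => x f0 fE [_ Sx].
by rewrite -fE// ger0_norm// f0.
Qed.

(** Change of variables [dnu = f dmu], after enlarging the domain from [M = supp nu] to [supp mu] by
    a [nu]-null set. *)
Lemma is_density_of_Rintegral (M : set (measurableTypeR R)) f nu
    (q : measurableTypeR R -> R) :
  measurable M -> M `<=` supp mu -> is_density_of mu M f nu ->
  L2 mu f -> L2 mu q ->
  \int[nu]_(x in M) q x = \int[mu]_(x in supp mu) (q x * f x).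
Proof.
move=> mM MS fnu Lf Lq; have f0 := is_density_of_ge0 fnu.
have [/AC2plus_dominates numu suppnu fE] := fnu.
have iqf := L2_integrableM Lq Lf; have [mq _] := Lq.
have iRN := @Radon_Nikodym_integrable _ _ _
  (charge_of_finite_measure nu) mu numu.
have iSF := Radon_Nikodym_SigmaFinite.f_integrable numu.
(* The integral of [|q|] under [nu] is that of [|q f|] under [mu], finite because both factors are
   in [L2]. *)
have iq : nu.-integrable (supp mu) (EFin \o q).
  apply/integrableP; split; first exact/measurable_EFinP.
  rewrite -(Radon_Nikodym_SigmaFinite.change_of_variables numu)//; last first.
    by apply: measurableT_comp => //; exact/measurable_EFinP.
  move/integrableP : iqf => [mqf]; apply: le_lt_trans.
  rewrite le_eqVlt; apply/orP; left; apply/eqP.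
  apply: ae_eq_integral => //.
  - apply: emeasurable_funM; last first.
      by apply: measurable_funTS; exact: measurable_int iSF.
    by apply: measurableT_comp => //; exact/measurable_EFinP.
  - exact: measurableT_comp.
  have := ae_eq_Radon_Nikodym_SigmaFinite numu measurableT.
  apply: (@filterS3 _ _ (ae_filter_ringOfSetsType mu)) f0 fE.
  move=> x f0 fE /(_ I) + Sx => ->.
  by rewrite -fE// EFinM abseM (gee0_abs (x := (f x)%:E))// lee_fin f0.
rewrite /Rintegral; congr fine.
have -> : M = supp mu `\` ~` supp nu by rewrite suppnu setDE setCK setIidr.
rewrite -negligible_integral//; last 2 first.
- by apply: measurableC; exact: measurable_supp.
- exact: measure_setC_supp.
rewrite -(Radon_Nikodym_change_of_variables numu)//.
apply: ae_eq_integral => //.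
- apply: emeasurable_funM; first exact/measurable_EFinP.
  by apply: measurable_funTS; exact: measurable_int iRN.
- exact: measurable_int iqf.
by apply: (@filterS _ _ (ae_filter_ringOfSetsType mu)) fE => x fE Sx;
  rewrite -fE// EFinM.
Qed.

Hypothesis mu_Cra : Cra mu.

(** The witness is [|f| dmu]; the work is to show that its derivative is [f] itself. *)
Lemma ex_is_density_of (M : set (measurableTypeR R)) f :
  measurable M -> L2 mu f ->
  supported_on mu M f -> nonneg_on mu M f ->
  exists nu, is_density_of mu M f nu.
Proof.
move=> mM Lf suppf f0.
(* [integral_measure] needs a density that is nonnegative everywhere and integrable on the whole
   line: [f] is nonnegative only almost everywhere on [M], and its values off [supp mu] are
   arbitrary. *)
pose h : measurableTypeR R -> R := (fun x => `|f x|) \_ (supp mu).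
have h0 x : 0 <= h x by rewrite /h patchE; case: ifP.
have mh : (EFin \o (fun x => `|f x|)) \_ (supp mu) = EFin \o h.
  exact: restrict_EFin.
have ih : mu.-integrable setT (EFin \o h).
  rewrite -mh; apply/(integrable_mkcond _ mS).
  exact: (L2_integrable mu_Cra (L2_norm Lf)).
pose nu : {finite_measure set (measurableTypeR R) -> \bar R} :=
  @integral_measure _ (measurableTypeR R) R mu h h0 ih.
have nuE A : nu A = density mu (fun x => `|f x|) A.
  by rewrite /density integral_mkcondr mh.
have suppnu : supp nu = M by rewrite -suppf; congr supp; apply/funext.
have nu_AC2 : AC2plus mu nu.
  by exists (fun x => `|f x|); [exact: L2_norm|move=> A _; rewrite -nuE].
exists nu; split=> //.
have numu := AC2plus_dominates nu_AC2.
(* On [M] this is the sign condition. Off [M], which is the support of [nu], the integral of [|f|]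
   is zero, so [f] vanishes almost everywhere. *)
have f_norm : {ae mu, forall x, supp mu x -> f x = `|f x|}.
  have mSM : measurable (~` M `&` supp mu).
    by apply: measurableI => //; exact: measurableC.
  have : ae_eq mu (~` M `&` supp mu) (EFin \o f) (cst 0%E).
    apply/ae_eq_integral_abs => //.
      apply/measurable_EFinP; apply: measurable_funS (Lf.1) => //.
    have : nu (~` supp nu) = 0%E by exact: measure_setC_supp.
    by rewrite suppnu nuE.
  apply: (@filterS2 _ _ (ae_filter_ringOfSetsType mu)) f0 => x f0 fM Sx.
  have [/f0/ger0_norm//|nMx] := pselect (M x).
  by have [->] := fM (conj nMx Sx); rewrite normr0.
(* Uniqueness of the density: both sides integrate to [nu A] over every measurable [A]. *)
have : ae_eq mu setT (EFin \o h)
    (Radon_Nikodym (charge_of_finite_measure nu) mu).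
  by apply: integral_ae_eq => // A _ mA; rewrite integral_Radon_Nikodym.
apply: (@filterS2 _ _ (ae_filter_ringOfSetsType mu)) f_norm.
by move=> x fx /(_ I) <- Sx; rewrite /= /h patchE mem_set// -fx.
Qed.

End density.

Theorem theorem1 (R : realType)
    (mu : {sigma_finite_measure set (measurableTypeR R) -> \bar R})
    (p : nat -> {poly R}) (c : nat -> R) (f : measurableTypeR R -> R)
    (M : set R)
    (hmu : Cra mu)
    (hp : orthogonal_polys mu p)
    (hc : cvgn (series (fun n : nat => c n ^+ 2 * phat mu p n)))
    (hf : mean_square_sum mu p c f)
    (Mclosed : closed M)
    (Msupp : M `<=` supp mu) :
  (supported_on mu M f /\ nonneg_on mu M f <->
   exists nu : {finite_measure set (measurableTypeR R) -> \bar R},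
     is_density_of mu M f nu) /\
  (forall nu : {finite_measure set (measurableTypeR R) -> \bar R},
     is_density_of mu M f nu ->
     forall n : nat,
       c n = (phat mu p n)^-1 * \int[nu]_(x in M) (p n).[x]).
Proof.
have Lf := hf.1.
have mM : measurable (M : set (measurableTypeR R)) by exact: closed_measurable.
split; first split.
- by move=> [suppf f0]; exact: ex_is_density_of.
- move=> [nu fnu]; split; last first.
    by apply: (@filterS _ _ (ae_filter_ringOfSetsType mu))
      (is_density_of_ge0 fnu) => x f0 /Msupp/f0.
  have [_ suppnu _] := fnu; rewrite /supported_on -suppnu.
  (* The support tests a set function on open sets only, so agreement there suffices for equal
     supports. *)
  have densE U : open U -> density mu (fun x => `|f x|) U = nu U.
    move=> oU; apply: is_density_of_norm fnu _; first exact: Lf.1.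
    exact: open_measurable.
  apply/seteqP; split=> x Sx U oU Ux; have := Sx U oU Ux;
    by rewrite densE.
- move=> nu fnu n.
  rewrite (is_density_of_Rintegral mM Msupp fnu Lf (L2_horner hmu (p n))).
  rewrite (mean_square_sum_coef hmu hp n hf) mulrC mulfK//.
  by case: hp => _ _ /(_ n) /lt0r_neq0.
Qed.
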